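(* As formal power series in $q$ with coefficients Laurent polynomials in $z$, \[ (1-z)(1-z^{-1})\,\overline{S2}(z,q)=\sum_{n=0}^\infty\sum_{m=-\infty}^\infty\bigl(N2(m,n)-M2(m,n)\bigr)z^mq^n . \]
   Context: Notation: $(a;q)_\infty=\prod_{k\ge0}(1-aq^k)$, $(a;q)_n=(a;q)_\infty/(aq^n;q)_\infty$. Define \[ \overline{S2}(z,q)=\sum_{n=1}^\infty\frac{q^{2n}(q^{2n+2};q^2)_\infty(-q^{2n+1};q^2)_\infty}{(zq^{2n};q^2)_\infty(z^{-1}q^{2n};q^2)_\infty}. \] The numbers $N2(m,n)$ (number of partitions of $n$ without repeated odd parts having $M_2$-rank $m$, where the $M_2$-rank of $\pi$ is $\lceil \ell(\pi)/2\rceil-\#(\pi)$ with $\ell(\pi)$ the largest part and $\#(\pi)$ the number of parts) are given by \[ \sum_{n\ge0}\sum_mN2(m,n)z^mq^n=\sum_{n=0}^\infty\frac{q^{n^2}(-q;q^2)_n}{(zq^2;q^2)_n(z^{-1}q^2;q^2)_n}, \] and the numbers $M2(m,n)$ are defined by \[ \sum_{n\ge0}\sum_mM2(m,n)z^mq^n=\frac{(-q;q^2)_\infty(q^2;q^2)_\infty}{(zq^2;q^2)_\infty(z^{-1}q^2;q^2)_\infty}. \] *)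

(* Defs.v *)
From HB Require Import structures.
From mathcomp Require Import all_boot all_order all_algebra.
From mathcomp Require Import fraction.
From Stdlib Require Import ClassicalEpsilon.
Set Implicit Arguments. Unset Strict Implicit. Unset Printing Implicit Defensive.
Import Order.TTheory GRing.Theory Num.Theory.
Local Open Scope ring_scope.

(* Coefficient field: rational functions in z over Z; it contains the ring
   Z[z, z^-1] of Laurent polynomials in z. *)
Definition K : fieldType := {fraction {poly int}}.
Definition zK : K := FracField.tofrac ('X : {poly int}).

Definition fps := nat -> K.
Definition fC (c : K) : fps := fun n => if n == 0%N then c else 0.
Definition fmon (c : K) (k : nat) : fps := fun n => if n == k then c else 0.
Definition fone : fps := fC 1.
Definition fadd (f g : fps) : fps := fun n => f n + g n.
Definition fopp (f : fps) : fps := fun n => - f n.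
Definition fsub (f g : fps) : fps := fadd f (fopp g).
Definition fmul (f g : fps) : fps := fun n => \sum_(i < n.+1) f i * g (n - i)%N.

Definition finv (f : fps) : fps :=
  match excluded_middle_informative (exists g : fps, fmul f g = fone) with
  | left H => proj1_sig (constructive_indefinite_description _ H)
  | right _ => fC 0
  end.
Definition fdiv (f g : fps) : fps := fmul f (finv g).

Definition flim (s : nat -> fps) : fps := fun n =>
  match excluded_middle_informative
          (exists c : K, exists J : nat, forall j, (J <= j)%N -> s j n = c) with
  | left H => proj1_sig (constructive_indefinite_description _ H)
  | right _ => 0
  end.

Fixpoint fprodn (F : nat -> fps) (N : nat) : fps :=
  match N with 0%N => fone | N'.+1 => fmul (fprodn F N') (F N') end.
Fixpoint fsumn (F : nat -> fps) (N : nat) : fps :=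
  match N with 0%N => fC 0 | N'.+1 => fadd (fsumn F N') (F N') end.
Definition fprod_inf (F : nat -> fps) : fps := flim (fprodn F).
Definition fsum_inf (F : nat -> fps) : fps := flim (fsumn F).

Definition poch2_fac (a : fps) (k : nat) : fps := fsub fone (fmul a (fmon 1 (2 * k))).
Definition poch2_inf (a : fps) : fps := fprod_inf (poch2_fac a).
Definition poch2 (a : fps) (n : nat) : fps := fprodn (poch2_fac a) n.

Definition S2bar_term (n : nat) : fps :=
  fdiv (fmul (fmon 1 (2 * n))
             (fmul (poch2_inf (fmon 1 (2 * n + 2))) (poch2_inf (fmon (-1) (2 * n + 1)))))
       (fmul (poch2_inf (fmon zK (2 * n))) (poch2_inf (fmon zK^-1 (2 * n)))).
Definition S2bar : fps := fsum_inf (fun j => S2bar_term j.+1).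

Definition lcoeff (x : K) (m : int) : int :=
  match excluded_middle_informative
          (exists pk : {poly int} * nat, x = FracField.tofrac pk.1 / zK ^+ pk.2) with
  | left H =>
      let pk := proj1_sig (constructive_indefinite_description _ H) in
      if (0 <= m + pk.2%:Z) then pk.1`_(absz (m + pk.2%:Z)) else 0
  | right _ => 0
  end.

Definition laurent (c : int -> int) : K :=
  match excluded_middle_informative
          (exists N : nat, forall m : int, (N < absz m)%N -> c m = 0) with
  | left H =>
      let N := proj1_sig (constructive_indefinite_description _ H) in
      \sum_(i < (2 * N).+1) (c (i%:Z - N%:Z))%:~R * zK ^ (i%:Z - N%:Z)
  | right _ => 0
  end.

Definition M2_gf : fps :=
  fdiv (fmul (poch2_inf (fmon (-1) 1)) (poch2_inf (fmon 1 2)))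
       (fmul (poch2_inf (fmon zK 2)) (poch2_inf (fmon zK^-1 2))).
Definition M2 (m : int) (n : nat) : int := lcoeff (M2_gf n) m.

(* A partition of n is encoded by its multiplicity function:
   f i = number of parts equal to i+1 (each multiplicity is <= n). *)
Definition ptn_sum n (f : {ffun 'I_n -> 'I_n.+1}) : nat := \sum_(i < n) (i.+1 * f i)%N.
Definition ptn_nparts n (f : {ffun 'I_n -> 'I_n.+1}) : nat := \sum_(i < n) (f i : nat).
Definition ptn_largest n (f : {ffun 'I_n -> 'I_n.+1}) : nat :=
  \max_(i < n | (0 < f i)%N) i.+1.
Definition ptn_no_rep_odd n (f : {ffun 'I_n -> 'I_n.+1}) : bool :=
  [forall i : 'I_n, odd i.+1 ==> (f i <= 1)%N].
Definition M2rank n (f : {ffun 'I_n -> 'I_n.+1}) : int :=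
  (uphalf (ptn_largest f))%:Z - (ptn_nparts f)%:Z.
Definition N2 (m : int) (n : nat) : nat :=
  #|[set f : {ffun 'I_n -> 'I_n.+1} |
       [&& ptn_sum f == n, ptn_no_rep_odd f & M2rank f == m]]|.

(* Main.v *)
Require Import Defs.
From HB Require Import structures.
From mathcomp Require Import all_boot all_order all_algebra.
From mathcomp Require Import fraction boolp.
From mathcomp Require Import ring zify.
Set Implicit Arguments. Unset Strict Implicit. Unset Printing Implicit Defensive.
Import Order.TTheory GRing.Theory Num.Theory.
Local Open Scope ring_scope.

(* Write Q = q^2 and w = 1/z, and let G_L = (-wq;Q)_L / (wQ;Q)_L, which generates
   the partitions without repeated odd parts and with largest part <= 2L, each part
   being weighted by w.  Grouping partitions by L = ceil(largest part / 2) shows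
   that the generating function of N2 is 1 + sum_{L >= 1} z^L (G_L - G_{L-1}),
   that is, (1 - z) sum_L z^L G_L up to convergence.  Heine's transformation turns
   this into (1 - z) Psi_0, where
     Psi_j = (Q;Q)_oo / (wQ;Q)_oo
             * sum_k (w;Q)_k / (Q;Q)_k Q^k (-qQ^{j+k};Q)_oo / (zQ^{j+k};Q)_oo;
   the term k = 0 is the generating function of M2 and the others make up
   (1 - z)(1 - w) S2bar.  The transformation is proved without double sums:
   Phi_j = sum_L (z Q^j)^L G_L and Psi_j satisfy the same recursion
     (1 - z Q^j) X_j = (1 - w) + (w + q Q^j) X_{j+1}
   and both tend q-adically to 1, so they agree for all j >= 1. *)

(** * The ring of formal power series and its q-adic limits *)

Lemma fps_eqP (f g : fps) : (forall n, f n = g n) -> f = g.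
Proof. exact: functional_extensionality_dep. Qed.

(** A coefficient of a product involves only truncations of the factors, so the ring laws of [fmul]
    can be read off from polynomials. *)
Lemma fmul_coefM (f g : fps) n N : (n < N)%N ->
  fmul f g n = ((\poly_(i < N) f i) * (\poly_(i < N) g i))`_n.
Proof.
move=> ltnN; rewrite coefM /fmul; apply: eq_bigr => i _; rewrite !coef_poly.
by have iN : (i < N)%N := leq_trans (ltn_ord i) ltnN; rewrite iN (leq_ltn_trans (leq_subr _ _)).
Qed.

Lemma fmulA : associative fmul.
Proof.
move=> f g h; apply: fps_eqP => n.
transitivity (((\poly_(i < n.+1) f i) * ((\poly_(i < n.+1) g i) * (\poly_(i < n.+1) h i)))`_n).
  rewrite coefM; apply: eq_bigr => i _.
  by rewrite coef_poly ltn_ord -fmul_coefM // ltnS leq_subr.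
rewrite mulrA coefM; apply: eq_bigr => i _.
by rewrite coef_poly ltnS leq_subr -fmul_coefM.
Qed.

Lemma fmulC : commutative fmul.
Proof.
by move=> f g; apply: fps_eqP => n; rewrite !(@fmul_coefM _ _ _ n.+1) // mulrC.
Qed.

Lemma fmul_fC c f n : fmul (fC c) f n = c * f n.
Proof.
rewrite /fmul big_ord_recl /fC /= subn0 big1 ?addr0 // => i _.
by rewrite mul0r.
Qed.

Lemma fmul1 : left_id fone fmul.
Proof. by move=> f; apply: fps_eqP => n; rewrite fmul_fC mul1r. Qed.

Lemma fmulDl : left_distributive fmul fadd.
Proof.
move=> f g h; apply: fps_eqP => n; rewrite /fmul /fadd -big_split.
by apply: eq_bigr => i _; rewrite mulrDl.
Qed.

Lemma faddA : associative fadd.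
Proof. by move=> f g h; apply: fps_eqP => n; apply: addrA. Qed.
Lemma faddC : commutative fadd.
Proof. by move=> f g; apply: fps_eqP => n; apply: addrC. Qed.
Lemma fadd0 : left_id (fC 0) fadd.
Proof. by move=> f; apply: fps_eqP => n; rewrite /fadd /fC if_same add0r. Qed.
Lemma faddN : left_inverse (fC 0) fopp fadd.
Proof. by move=> f; apply: fps_eqP => n; rewrite /fadd /fC /fopp if_same addNr. Qed.

HB.instance Definition _ := gen_eqMixin fps.
HB.instance Definition _ := gen_choiceMixin fps.
HB.instance Definition _ := GRing.isZmodule.Build fps faddA faddC fadd0 faddN.

Lemma fone_neq0 : fone != 0 :> fps.
Proof. by apply/eqP => /(congr1 (@^~ 0%N)) /eqP; rewrite /fone /fC /= oner_eq0. Qed.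

HB.instance Definition _ :=
  GRing.Zmodule_isComNzRing.Build fps fmulA fmulC fmul1 fmulDl fone_neq0.

(** This is exactly the condition tested by [finv], so that the ring inverse agrees with [finv] on
    units. Elsewhere [finv] returns 0 whereas the ring structure asks for the identity, hence the
    case split in [funit_inv]. *)
Definition funit (f : fps) : bool := `[< exists g, fmul f g = fone >].
Definition funit_inv (f : fps) : fps := if funit f then Defs.finv f else f.

Lemma finvP f : funit f -> fmul f (Defs.finv f) = fone.
Proof.
move=> /asboolP uf; rewrite /Defs.finv; case: ClassicalEpsilon.excluded_middle_informative => // H.
by case: (ClassicalEpsilon.constructive_indefinite_description _ H).
Qed.

Lemma funit_mulV : {in funit, left_inverse 1 funit_inv *%R}.
Proof.
by move=> f uf; have {}uf : funit f := uf; rewrite mulrC /funit_inv uf; apply: finvP.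
Qed.

Lemma funit_intro (f g : fps) : g * f = 1 -> funit f.
Proof. by move=> gf; apply/asboolP; exists g; rewrite fmulC. Qed.

Lemma funit_out : {in [predC funit], funit_inv =1 id}.
Proof. by move=> f nuf; have {}nuf : ~~ funit f := nuf; rewrite /funit_inv (negbTE nuf). Qed.

HB.instance Definition _ :=
  GRing.ComNzRing_hasMulInverse.Build fps funit_mulV funit_intro funit_out.

Lemma fdivE (f g : fps) : g \is a GRing.unit -> fdiv f g = f / g.
Proof.
by move=> ug; rewrite /fdiv -[g^-1]/(funit_inv g) /funit_inv; have -> : funit g = true := ug.
Qed.

Lemma coefDf (f g : fps) n : (f + g) n = f n + g n. Proof. by []. Qed.
Lemma coefNf (f : fps) n : (- f) n = - f n. Proof. by []. Qed.
Lemma coefBf (f g : fps) n : (f - g) n = f n - g n. Proof. by []. Qed.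
Lemma coef0f n : (0 : fps) n = 0. Proof. by rewrite -[0]/(fC 0) /fC if_same. Qed.
Lemma coefMf (f g : fps) n : (f * g) n = \sum_(i < n.+1) f i * g (n - i)%N.
Proof. by []. Qed.
Lemma coef_sumf I (r : seq I) (P : pred I) (F : I -> fps) n :
  (\sum_(i <- r | P i) F i) n = \sum_(i <- r | P i) F i n.
Proof. exact: (big_morph (fun f : fps => f n) (fun f g => coefDf f g n) (coef0f n)). Qed.
Lemma coefMCf c (f : fps) n : (fC c * f) n = c * f n.
Proof. exact: fmul_fC. Qed.

Lemma fCD a b : fC (a + b) = fC a + fC b.
Proof. by apply: fps_eqP => -[|n]; rewrite coefDf /fC //= addr0. Qed.
Lemma fCN a : fC (- a) = - fC a.
Proof. by apply: fps_eqP => -[|n]; rewrite coefNf /fC //= oppr0. Qed.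
Lemma fCM a b : fC (a * b) = fC a * fC b.
Proof. by apply: fps_eqP => n; rewrite coefMCf /fC; case: ifP; rewrite ?mulr0. Qed.
Lemma fC1 : fC 1 = 1. Proof. by []. Qed.

Lemma fCX c k : fC (c ^+ k) = fC c ^+ k.
Proof. by elim: k => // k IH; rewrite !exprS fCM IH. Qed.

(** * The variable q and monomials *)

Definition q : fps := fmon 1 1.

Lemma coef_qM f n : (q * f) n = if n is n'.+1 then f n' else 0.
Proof.
case: n => [|n]; rewrite coefMf big_ord_recl {1}/q /fmon /= mul0r ?big_ord0 ?addr0 //.
rewrite big_ord_recl /q /fmon /= subn1 mul1r big1 ?addr0 ?add0r // => i _.
by rewrite /bump /= mul0r.
Qed.

Lemma fmonE c k : fmon c k = fC c * q ^+ k.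
Proof.
elim: k => [|k IH]; first by rewrite expr0 mulr1.
rewrite exprS mulrCA -IH; apply: fps_eqP => -[|n].
  by rewrite coef_qM.
by rewrite coef_qM /fmon eqSS.
Qed.

Lemma coef_qXM k f n : (q ^+ k * f) n = if (n < k)%N then 0 else f (n - k)%N.
Proof.
elim: k n => [|k IH] n; first by rewrite expr0 mul1r subn0.
by rewrite exprS -mulrA coef_qM; case: n => // n; rewrite IH ltnS subSS.
Qed.

(** * Congruence modulo q^N and inversion of series *)

Definition eqm N (f g : fps) := forall i, (i < N)%N -> f i = g i.

Lemma eqm_refl N f : eqm N f f. Proof. by []. Qed.
Lemma eqm_sym N f g : eqm N f g -> eqm N g f.
Proof. by move=> fg i /fg. Qed.
Lemma eqm_trans N g f h : eqm N f g -> eqm N g h -> eqm N f h.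
Proof. by move=> fg gh i iN; rewrite fg ?gh. Qed.
Lemma eqmW N M f g : (M <= N)%N -> eqm N f g -> eqm M f g.
Proof. by move=> MN fg i iM; apply: fg; apply: leq_trans MN. Qed.
Lemma eqm_eq f g : (forall N, eqm N f g) -> f = g.
Proof. by move=> fg; apply: fps_eqP => n; apply: (fg n.+1). Qed.
Lemma eqmD N f g f' g' : eqm N f g -> eqm N f' g' -> eqm N (f + f') (g + g').
Proof. by move=> fg fg' i iN; rewrite !coefDf fg ?fg'. Qed.
Lemma eqmN N f g : eqm N f g -> eqm N (- f) (- g).
Proof. by move=> fg i iN; rewrite !coefNf fg. Qed.
Lemma eqmB N f g f' g' : eqm N f g -> eqm N f' g' -> eqm N (f - f') (g - g').
Proof. by move=> fg fg'; apply: eqmD (eqmN _). Qed.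
Lemma eqmM N f g f' g' : eqm N f g -> eqm N f' g' -> eqm N (f * f') (g * g').
Proof.
move=> fg fg' i iN; rewrite !coefMf; apply: eq_bigr => j _.
by rewrite fg ?fg' //; have := ltn_ord j; lia.
Qed.
Lemma eqm_sum N I (r : seq I) (P : pred I) (F G : I -> fps) :
  (forall i, P i -> eqm N (F i) (G i)) ->
  eqm N (\sum_(i <- r | P i) F i) (\sum_(i <- r | P i) G i).
Proof. by move=> FG; apply: (big_ind2 (eqm N)) => // *; apply: eqmD. Qed.
Lemma eqm_prod N I (r : seq I) (P : pred I) (F G : I -> fps) :
  (forall i, P i -> eqm N (F i) (G i)) ->
  eqm N (\prod_(i <- r | P i) F i) (\prod_(i <- r | P i) G i).
Proof. by move=> FG; apply: (big_ind2 (eqm N)) => // *; apply: eqmM. Qed.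
Lemma eqm_sum0 N I (r : seq I) (P : pred I) (F : I -> fps) :
  (forall i, P i -> eqm N (F i) 0) -> eqm N (\sum_(i <- r | P i) F i) 0.
Proof.
move=> F0; have := @eqm_sum N I r P F (fun=> 0) F0.
by rewrite big1_eq.
Qed.
Lemma eqm_prod1 N I (r : seq I) (P : pred I) (F : I -> fps) :
  (forall i, P i -> eqm N (F i) 1) -> eqm N (\prod_(i <- r | P i) F i) 1.
Proof.
move=> F1; have := @eqm_prod N I r P F (fun=> 1) F1.
by rewrite big1_eq.
Qed.
Lemma eqm_qXM N f : eqm N (q ^+ N * f) 0.
Proof. by move=> i iN; rewrite coef_qXM iN coef0f. Qed.
Lemma eqm_qX N k f : (N <= k)%N -> eqm N (q ^+ k * f) 0.
Proof. by move=> Nk; apply: eqmW Nk (@eqm_qXM _ _). Qed.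

Lemma q_factor (h : fps) : h 0%N = 0 -> exists g, h = q * g.
Proof.
move=> h0; exists (fun n => h n.+1); apply: fps_eqP => -[|n]; by rewrite coef_qM.
Qed.

Lemma eqm_exp (h : fps) k : h 0%N = 0 -> eqm k (h ^+ k) 0.
Proof. by move=> /q_factor[g ->]; rewrite exprMn; apply: eqm_qXM. Qed.

(** The geometric series of h. When h has no constant term, h^k starts at q^k or later, so the
    powers up to n determine coefficient n. *)
Definition geom (h : fps) : fps := fun n => (\sum_(k < n.+1) h ^+ k) n.

Lemma geom_eqm (h : fps) N : h 0%N = 0 -> eqm N (geom h) (\sum_(k < N) h ^+ k).
Proof.
move=> h0 i iN; rewrite /geom -(big_mkord predT (fun k => h ^+ k)).
rewrite -(big_mkord predT (fun k => h ^+ k)) [in RHS](big_cat_nat (n := i.+1)) //=.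
have tail : (\sum_(i.+1 <= k < N) h ^+ k) i = 0.
  rewrite coef_sumf big_nat_cond big1 // => k /andP[/andP[ik _] _].
  by rewrite (eqm_exp (k := k) h0) ?coef0f.
by rewrite coefDf tail addr0.
Qed.

Lemma geomK (h : fps) : h 0%N = 0 -> (1 - h) * geom h = 1.
Proof.
move=> h0; apply: eqm_eq => N.
apply: (eqm_trans (eqmM (@eqm_refl N (1 - h)) (geom_eqm (N := N) h0))).
have -> : (1 - h) * (\sum_(k < N) h ^+ k) = 1 - h ^+ N.
  by rewrite -[1 - h ^+ N]opprB subrX1 -mulNr opprB.
by rewrite -[X in eqm _ _ X]subr0; apply: eqmB => //; apply: eqm_exp.
Qed.

Lemma unit_fpsP (f : fps) : f 0%N = 1 -> f \is a GRing.unit.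
Proof.
move=> f0; apply/unitrP; exists (geom (1 - f)).
have h0 : (1 - f) 0%N = 0 by rewrite coefBf f0 subrr.
by have := geomK h0; rewrite opprB addrC subrK mulrC => H; split=> //; rewrite mulrC.
Qed.

Lemma geomE (f : fps) : f 0%N = 1 -> f^-1 = geom (1 - f).
Proof.
move=> f0; have h0 : (1 - f) 0%N = 0 by rewrite coefBf f0 subrr.
apply: (mulrI (unit_fpsP f0)); rewrite mulrV ?unit_fpsP //.
by have := geomK h0; rewrite opprB addrC subrK.
Qed.

Lemma coef0Mf (f g : fps) : (f * g) 0%N = f 0%N * g 0%N.
Proof. by rewrite coefMf big_ord_recl big_ord0 addr0. Qed.

Lemma unit_fps (f : fps) : f 0%N != 0 -> f \is a GRing.unit.
Proof.
move=> f0; have -> : f = fC (f 0%N) * (fC (f 0%N)^-1 * f).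
  by rewrite mulrA -fCM divff // mul1r.
rewrite unitrM; apply/andP; split; last by apply: unit_fpsP; rewrite coef0Mf /fC /= mulVf.
by apply/unitrP; exists (fC (f 0%N)^-1); rewrite -!fCM mulVf // mulfV.
Qed.

Lemma eqmV N (f g : fps) : f \is a GRing.unit -> g \is a GRing.unit -> eqm N f g ->
  eqm N f^-1 g^-1.
Proof.
move=> uf ug fg; have -> : f^-1 = f^-1 * (g - f) * g^-1 + g^-1.
  by rewrite mulrBr mulVr // mulrBl mulrK // mul1r subrK.
rewrite -[X in eqm _ _ X]add0r; apply: eqmD => //.
rewrite -[X in eqm _ _ X](mul0r g^-1); apply: eqmM => //.
rewrite -[X in eqm _ _ X](mulr0 f^-1); apply: eqmM => //.
by rewrite -[X in eqm _ _ X](subrr g); apply: eqmB.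
Qed.

(** * Limits with the fixed rate q^j *)

Definition lim_to (s : nat -> fps) (l : fps) := forall j, eqm j (s j) l.

Lemma lim_uniq s l l' : lim_to s l -> lim_to s l' -> l = l'.
Proof. by move=> sl sl'; apply: eqm_eq => N; apply: eqm_trans (eqm_sym (sl N)) _. Qed.
Lemma limD s t l m : lim_to s l -> lim_to t m -> lim_to (fun j => s j + t j) (l + m).
Proof. by move=> sl tm j; apply: eqmD. Qed.
Lemma limB s t l m : lim_to s l -> lim_to t m -> lim_to (fun j => s j - t j) (l - m).
Proof. by move=> sl tm j; apply: eqmB. Qed.
Lemma limM s t l m : lim_to s l -> lim_to t m -> lim_to (fun j => s j * t j) (l * m).
Proof. by move=> sl tm j; apply: eqmM. Qed.
Lemma limZ f s l : lim_to s l -> lim_to (fun j => f * s j) (f * l).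
Proof. by move=> sl; apply: limM. Qed.
Lemma limS s l : lim_to s l -> lim_to (fun j => s j.+1) l.
Proof. by move=> sl j; apply: eqmW (sl j.+1). Qed.
Lemma lim_ext s t l : s =1 t -> lim_to s l -> lim_to t l.
Proof. by move=> st sl j; rewrite -st. Qed.
Lemma limV s l : (forall j, s j \is a GRing.unit) -> l \is a GRing.unit ->
  lim_to s l -> lim_to (fun j => (s j)^-1) l^-1.
Proof. by move=> us ul sl j; apply: eqmV. Qed.

(** Coefficient n is constant from index n + 1 on, so the value chosen by [flim] can be compared
    with [s j] at any index beyond both j and the chosen threshold. *)
Lemma lim_flim s : (forall j, eqm j (s j.+1) (s j)) -> lim_to s (flim s).
Proof.
move=> cs; have cs' n d : s (n.+1 + d)%N n = s n.+1 n.
  by elim: d => [|d <-]; rewrite ?addn0 // addnS; apply: cs; lia.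
move=> j i ij; rewrite /flim; case: ClassicalEpsilon.excluded_middle_informative => [H|[]].
  case: (ClassicalEpsilon.constructive_indefinite_description _ H) => c [J HJ] /=.
  rewrite -(HJ (maxn J j)) ?leq_maxl //.
  have -> : maxn J j = (i.+1 + (maxn J j - i.+1))%N by have := leq_maxr J j; lia.
  have -> : j = (i.+1 + (j - i.+1))%N by lia.
  by rewrite !cs'.
exists (s i.+1 i), i.+1 => k ik; have -> : k = (i.+1 + (k - i.+1))%N by lia.
by rewrite cs'.
Qed.

Lemma fsumnE F N : fsumn F N = \sum_(k < N) F k.
Proof. by elim: N => [|N IH]; rewrite ?big_ord0 // big_ord_recr /= -IH. Qed.
Lemma fprodnE F N : fprodn F N = \prod_(k < N) F k.
Proof. by elim: N => [|N IH]; rewrite ?big_ord0 // big_ord_recr /= -IH. Qed.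

Lemma lim_sum F : (forall k, eqm k (F k) 0) -> lim_to (fun N => \sum_(k < N) F k) (fsum_inf F).
Proof.
move=> F0; apply: (@lim_ext (fsumn F)) => [N|]; first exact: fsumnE.
apply: lim_flim => j; rewrite -[X in eqm _ _ X]addr0.
exact: eqmD.
Qed.
Lemma lim_prod F : (forall k, eqm k (F k) 1) -> lim_to (fun N => \prod_(k < N) F k) (fprod_inf F).
Proof.
move=> F0; apply: (@lim_ext (fprodn F)) => [N|]; first exact: fprodnE.
apply: lim_flim => j; rewrite -[X in eqm _ _ X]mulr1.
exact: eqmM.
Qed.

(** * Heine's transformation *)

Lemma poch2_facE a k : poch2_fac a k = 1 - a * q ^+ (2 * k).
Proof. by rewrite /poch2_fac fmonE fC1 mul1r. Qed.

Lemma poch2_0 a : poch2 a 0 = 1. Proof. by []. Qed.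

Lemma poch2S a n : poch2 a n.+1 = poch2 a n * (1 - a * q ^+ (2 * n)).
Proof. by rewrite -poch2_facE. Qed.

Lemma poch2_fac_eqm1 a k : eqm k (poch2_fac a k) 1.
Proof.
rewrite poch2_facE -[X in eqm _ _ X]subr0 mulrC; apply: eqmB => //.
by apply: eqm_qX; lia.
Qed.

Lemma poch2_lim a : lim_to (poch2 a) (poch2_inf a).
Proof.
apply: (@lim_ext (fun N => \prod_(k < N) poch2_fac a k)).
  by move=> N; rewrite -fprodnE.
by apply: lim_prod => k; apply: poch2_fac_eqm1.
Qed.

Lemma poch2_recl a n : poch2 a n.+1 = (1 - a) * poch2 (a * q ^+ 2) n.
Proof.
elim: n => [|n IH]; first by rewrite poch2S !poch2_0 muln0 expr0 !mulr1 mul1r.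
rewrite poch2S IH poch2S -[LHS]mulrA -[_ * q ^+ 2 * _]mulrA -exprD.
by congr (_ * (_ * (1 - a * q ^+ _))); lia.
Qed.

Lemma poch2_inf_recl a : poch2_inf a = (1 - a) * poch2_inf (a * q ^+ 2).
Proof.
apply: (lim_uniq (limS (poch2_lim a))).
apply: (lim_ext (s := fun n => (1 - a) * poch2 (a * q ^+ 2) n)) => [n|].
  by rewrite poch2_recl.
exact: limZ (poch2_lim _).
Qed.

Lemma poch2_infE a n : poch2_inf a = poch2 a n * poch2_inf (a * q ^+ (2 * n)).
Proof.
elim: n => [|n IH]; first by rewrite poch2_0 mul1r expr0 mulr1.
rewrite IH poch2_inf_recl poch2S -!mulrA -exprD; do 2 congr (_ * _).
by congr (poch2_inf (_ * q ^+ _)); lia.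
Qed.

Lemma poch2_inf_eqm1 a N : eqm N (poch2_inf (a * q ^+ N)) 1.
Proof.
apply: (eqm_trans (eqm_sym (poch2_lim _ (j := N)))).
rewrite -[poch2 _ _]/(fprodn _ _) fprodnE; apply: eqm_prod1 => k _; rewrite poch2_facE -[X in eqm _ _ X]subr0; apply: eqmB => //.
by rewrite -mulrA -exprD mulrC; apply: eqm_qX; lia.
Qed.

Lemma coef0_poch2 (a : fps) n : a 0%N = 0 -> poch2 a n 0%N = 1.
Proof.
move=> a0; elim: n => // n IH.
by rewrite poch2S coef0Mf IH mul1r coefBf coef0Mf a0 mul0r subr0.
Qed.

Lemma coef0_poch2_inf (a : fps) : poch2_inf a 0%N = 1 - a 0%N.
Proof.
rewrite -(poch2_lim a (j := 1)) // poch2S poch2_0 muln0 expr0 mulr1 mul1r.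
by rewrite coefBf.
Qed.

Lemma coef0_qM a n : (0 < n)%N -> (a * q ^+ n) 0%N = 0.
Proof. by move=> n0; rewrite mulrC coef_qXM n0. Qed.

Lemma unit_poch2 a n k : (0 < n)%N -> poch2 (a * q ^+ n) k \is a GRing.unit.
Proof. by move=> n0; apply: unit_fpsP; rewrite coef0_poch2 // coef0_qM. Qed.

Lemma unit_poch2_inf a n : (0 < n)%N -> poch2_inf (a * q ^+ n) \is a GRing.unit.
Proof. by move=> n0; apply: unit_fpsP; rewrite coef0_poch2_inf coef0_qM // subr0. Qed.

Lemma unit_1BqM a n : (0 < n)%N -> 1 - a * q ^+ n \is a GRing.unit.
Proof. by move=> n0; apply: unit_fpsP; rewrite coefBf coef0_qM // subr0. Qed.

Lemma zK_neq0 : zK != 0.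
Proof. by rewrite tofrac_eq0 polyX_eq0. Qed.

(** The constant coefficient of (z;Q)_oo is 1 - z; it has to be invertible for [Psi 0] to make
    sense. *)
Lemma zK_neq1 : 1 - zK != 0.
Proof.
rewrite -tofrac1 -tofracB tofrac_eq0 subr_eq0; apply/eqP => /(congr1 (fun p : {poly int} => p`_1)).
by rewrite coefX coef1.
Qed.

Definition z : fps := fC zK.
Definition w : fps := fC zK^-1.

Lemma zw : z * w = 1. Proof. by rewrite -fCM divff ?zK_neq0. Qed.

(** * The ratios G_L and the series Phi_j *)

Definition G (L : nat) : fps := poch2 (- w * q ^+ 1) L / poch2 (w * q ^+ 2) L.

Lemma G0 : G 0 = 1. Proof. by rewrite /G !poch2_0 divr1. Qed.

Lemma mulf_ratio_cancel (a b c d : fps) : b \is a GRing.unit -> d \is a GRing.unit ->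
  (a * c) / (b * d) * d = a / b * c.
Proof.
by move=> ub ud; rewrite [b * d]mulrC invrM // mulrA mulrVK // mulrAC.
Qed.

Lemma G_rec L : G L.+1 * (1 - w * q ^+ (2 * L.+1)) = G L * (1 + w * q ^+ (2 * L).+1).
Proof.
rewrite /G !poch2S.
have -> : 1 - w * q ^+ (2 * L.+1) = 1 - w * q ^+ 2 * q ^+ (2 * L).
  by rewrite -mulrA -exprD; congr (1 - _ * q ^+ _); lia.
rewrite mulf_ratio_cancel ?unit_poch2 //; last by rewrite -mulrA -exprD unit_1BqM.
by congr (_ * _); rewrite -mulrA -exprD add1n mulNr opprK.
Qed.

Definition phi_term j L : fps := (z * q ^+ (2 * j)) ^+ L * G L.
Definition Phi j : fps := fsum_inf (phi_term j).

Lemma phi_termE j L : phi_term j L = z ^+ L * q ^+ (2 * j * L) * G L.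
Proof. by rewrite /phi_term exprMn -exprM. Qed.

Lemma phi_termS j L :
  phi_term j.+1 L = (z * q ^+ (2 * j)) ^+ L * q ^+ (2 * L) * G L.
Proof.
rewrite phi_termE [(z * _) ^+ L]exprMn -exprM -[z ^+ L * _ * q ^+ _]mulrA -exprD.
by congr (z ^+ L * q ^+ _ * G L); rewrite mulnS mulnDl addnC.
Qed.

(** The factor q^(2jL) forces convergence. At j = 0 the constant coefficients z^L do not tend to 0,
    so [Phi 0] is avoided. *)
Lemma phi_term_small j L : (0 < j)%N -> eqm L (phi_term j L) 0.
Proof.
move=> j0; rewrite /phi_term exprMn mulrAC mulrC -exprM; apply: eqm_qX.
by nia.
Qed.

Lemma Phi_lim j : (0 < j)%N -> lim_to (fun N => \sum_(L < N) phi_term j L) (Phi j).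
Proof. by move=> j0; apply: lim_sum => L; apply: phi_term_small. Qed.

Definition N2_gf_part (N : nat) : fps := 1 + \sum_(L < N) z ^+ L.+1 * (G L.+1 - G L).

(** By [G_rec], G_{L+1} - G_L = w q^(2L+2) G_{L+1} + w q^(2L+1) G_L. Multiplied by z^(L+1), and with
    z w = 1, the two summands become terms of the series Phi_1. *)
Lemma N2_gf_partE N :
  N2_gf_part N = (1 - w) + w * (\sum_(L < N.+1) phi_term 1 L)
             + q * (\sum_(L < N) phi_term 1 L).
Proof.
rewrite /N2_gf_part; elim: N => [|N IH].
  by rewrite !big_ord_recl !big_ord0 /phi_term expr0 G0; ring.
rewrite big_ord_recr /= addrA IH [X in _ = _ + _ * X + _]big_ord_recr /=.
rewrite [X in _ = _ + _ * X]big_ord_recr /=.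
have -> : z ^+ N.+1 * (G N.+1 - G N) = w * phi_term 1 N.+1 + q * phi_term 1 N; last by ring.
have -> : G N.+1 - G N = w * q ^+ (2 * N.+1) * G N.+1 + w * q ^+ (2 * N).+1 * G N.
  have := G_rec N; rewrite mulrBr mulrDr !mulr1 => /eqP; rewrite subr_eq => /eqP E.
  by rewrite [in LHS]E; ring.
rewrite !phi_termE !muln1 mulrDr; congr (_ + _); first by ring.
rewrite exprS [q ^+ _.+1]exprS; have := zw => H.
transitivity (z * w * q * z ^+ N * q ^+ (2 * N) * G N); first by ring.
by rewrite H; ring.
Qed.

Lemma Phi_rec j : (0 < j)%N ->
  (1 - z * q ^+ (2 * j)) * Phi j =
  (1 - w) + (w + q ^+ (2 * j).+1) * Phi j.+1.
Proof.
move=> j0; set x := z * q ^+ (2 * j).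
pose S i N := \sum_(L < N) phi_term i L.
(* The recursion already holds exactly for partial sums, provided that the multiplication by x is
   matched by one term less: both sides grow by x^(N+1) (G_{N+1} - G_N). *)
have E N : S j N.+1 - x * S j N = (1 - w) + w * S j.+1 N.+1 + q ^+ (2 * j).+1 * S j.+1 N.
  rewrite /S; elim: N => [|N IH].
    by rewrite !big_ord_recl !big_ord0 /phi_term !expr0 G0; ring.
  rewrite big_ord_recr [X in _ - _ * X]big_ord_recr /=.
  rewrite [X in _ = _ + _ * X + _]big_ord_recr [X in _ = _ + _ * X]big_ord_recr /=.
  have H : phi_term j N.+1 - x * phi_term j N = w * phi_term j.+1 N.+1 + q ^+ (2 * j).+1 * phi_term j.+1 N.
    have H2 : w * phi_term j.+1 N.+1 = x ^+ N.+1 * (w * q ^+ (2 * N.+1) * G N.+1).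
      by rewrite phi_termS -/x; ring.
    have H3 : q ^+ (2 * j).+1 * phi_term j.+1 N = x ^+ N.+1 * (w * q ^+ (2 * N).+1 * G N).
      rewrite phi_termS -/x exprS [x ^+ N.+1]exprS [q ^+ (2 * N).+1]exprS {2}/x.
      transitivity (z * w * (q * q ^+ (2 * j) * x ^+ N * q ^+ (2 * N) * G N)).
        by rewrite zw; ring.
      by ring.
    have H4 : x * phi_term j N = x ^+ N.+1 * G N by rewrite exprS -mulrA.
    rewrite H2 H3 H4 [phi_term j N.+1]/(x ^+ N.+1 * G N.+1).
    rewrite -!mulrDr -mulrBr; congr (_ * _).
    have := G_rec N; rewrite mulrBr mulrDr !mulr1 => /eqP; rewrite subr_eq => /eqP E.
    by rewrite [in LHS]E; ring.
  move/eqP: IH; rewrite subr_eq => /eqP ->.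
  move/eqP: H; rewrite subr_eq => /eqP ->.
  by ring.
apply: (lim_uniq (s := fun N => S j N.+1 - x * S j N)).
  rewrite mulrBl mul1r; apply: limB; first exact: limS (Phi_lim j0).
  exact: limZ (Phi_lim j0).
apply: lim_ext (fun N => esym (E N)) _.
rewrite mulrDl addrA; apply: limD; last exact: limZ (Phi_lim _).
by apply: limD => //; apply: limZ; exact: limS (Phi_lim _).
Qed.

(** The right-hand side of the recursion at j = 0, a substitute for (1 - z) Phi_0 that avoids the
    divergent series. *)
Definition N2_gf : fps := (1 - w) + (w + q) * Phi 1.

Lemma N2_gf_lim : lim_to N2_gf_part N2_gf.
Proof.
apply: lim_ext (fun N => esym (N2_gf_partE N)) _.
rewrite /N2_gf mulrDl addrA; apply: limD; last exact: limZ (Phi_lim _).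
by apply: limD => //; apply: limZ; exact: limS (Phi_lim _).
Qed.

Lemma Phi_eqm1 j : (0 < j)%N -> eqm j (Phi j) 1.
Proof.
move=> j0; apply: (eqm_trans (eqm_sym (@Phi_lim j j0 j))).
case: j j0 => // j _; rewrite big_ord_recl /phi_term expr0 G0 mulr1.
rewrite -[X in eqm _ _ X]addr0; apply: eqmD => //.
apply: eqm_sum0 => k _; rewrite exprMn mulrAC mulrC -exprM; apply: eqm_qX.
by rewrite -mulnA mulnCA leq_pmulr // muln_gt0.
Qed.

(** * The transformed series Psi_j *)

Definition tail_ratio i : fps := poch2_inf (- q ^+ (2 * i).+1) / poch2_inf (z * q ^+ (2 * i)).
Definition heine_coef k : fps := poch2 w k / poch2 (q ^+ 2) k.
Definition heine_cst : fps := poch2_inf (q ^+ 2) / poch2_inf (w * q ^+ 2).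
Definition psi_term j k : fps := heine_coef k * q ^+ (2 * k) * tail_ratio (j + k).
Definition Psi j : fps := heine_cst * fsum_inf (psi_term j).

Lemma heine_coef0 : heine_coef 0 = 1. Proof. by rewrite /heine_coef !poch2_0 divr1. Qed.

Lemma unit_poch2q k : poch2 (q ^+ 2) k \is a GRing.unit.
Proof. by rewrite -[q ^+ 2]mul1r; apply: unit_poch2. Qed.

Lemma heine_coefS k : heine_coef k.+1 * (1 - q ^+ (2 * k.+1)) = heine_coef k * (1 - w * q ^+ (2 * k)).
Proof.
have E : 1 - q ^+ (2 * k.+1) = 1 - q ^+ 2 * q ^+ (2 * k).
  by rewrite -exprD; congr (1 - q ^+ _); lia.
rewrite /heine_coef !poch2S E mulf_ratio_cancel ?unit_poch2q //.
by rewrite -exprD -[q ^+ _]mul1r unit_1BqM.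
Qed.

Lemma unit_tail_ratio_den i : poch2_inf (z * q ^+ (2 * i)) \is a GRing.unit.
Proof.
case: i => [|i]; last by apply: unit_poch2_inf.
by apply: unit_fps; rewrite coef0_poch2_inf muln0 expr0 mulr1 zK_neq1.
Qed.

(** The first factor of each infinite product is split off. *)
Lemma tail_ratio_rec i : (1 - z * q ^+ (2 * i)) * tail_ratio i = (1 + q ^+ (2 * i).+1) * tail_ratio i.+1.
Proof.
have ud := unit_tail_ratio_den i.
have E : poch2_inf (z * q ^+ (2 * i)) = (1 - z * q ^+ (2 * i)) * poch2_inf (z * q ^+ (2 * i.+1)).
  by rewrite poch2_inf_recl -mulrA -exprD; congr (_ * poch2_inf (z * q ^+ _)); lia.
have F : poch2_inf (- q ^+ (2 * i).+1) = (1 + q ^+ (2 * i).+1) * poch2_inf (- q ^+ (2 * i.+1).+1).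
  rewrite poch2_inf_recl opprK mulNr -exprD; congr (_ * poch2_inf (- q ^+ _)); lia.
have u1 : 1 - z * q ^+ (2 * i) \is a GRing.unit by move: ud; rewrite E unitrM => /andP[].
have := mulf_ratio_cancel (poch2_inf (- q ^+ (2 * i.+1).+1)) (1 + q ^+ (2 * i).+1) (unit_tail_ratio_den i.+1) u1.
by rewrite mulrC [_ * (1 + _)]mulrC [poch2_inf _ * (1 - _)]mulrC -E -F [RHS]mulrC.
Qed.

Lemma tail_ratio_eqm1 i : eqm i (tail_ratio i) 1.
Proof.
rewrite /tail_ratio -[X in eqm _ _ X]mulr1 -[X in eqm _ _ (1 * X)]invr1.
apply: eqmM.
  have -> : - q ^+ (2 * i).+1 = (- q ^+ i.+1) * q ^+ i.
    by rewrite mulNr -exprD; congr (- q ^+ _); lia.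
  exact: poch2_inf_eqm1.
apply: eqmV; rewrite ?unitr1 ?unit_tail_ratio_den //.
have -> : z * q ^+ (2 * i) = (z * q ^+ i) * q ^+ i by rewrite -mulrA -exprD addnn mul2n.
exact: poch2_inf_eqm1.
Qed.

Lemma psi_term_small j k : eqm k (psi_term j k) 0.
Proof. by rewrite /psi_term mulrAC mulrC; apply: eqm_qX; lia. Qed.

Lemma Psi_lim j : lim_to (fun N => heine_cst * \sum_(k < N) psi_term j k) (Psi j).
Proof. by apply: limZ; apply: lim_sum => k; apply: psi_term_small. Qed.

Lemma unit_heine_cst_den : poch2_inf (w * q ^+ 2) \is a GRing.unit.
Proof. exact: unit_poch2_inf. Qed.

Lemma unit_poch2q_inf : poch2_inf (q ^+ 2) \is a GRing.unit.
Proof. by rewrite -[q ^+ 2]mul1r; apply: unit_poch2_inf. Qed.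

Lemma heine_coef_lim : lim_to heine_coef (poch2_inf w / poch2_inf (q ^+ 2)).
Proof.
apply: limM; first exact: poch2_lim.
by apply: limV; [exact: unit_poch2q | exact: unit_poch2q_inf | exact: poch2_lim].
Qed.

(** (Q;Q)_oo cancels and (w;Q)_oo = (1 - w) (wQ;Q)_oo. This is the source of the constant 1 - w in
    [Psi_rec]. *)
Lemma heine_cst_coef : heine_cst * (poch2_inf w / poch2_inf (q ^+ 2)) = 1 - w.
Proof.
rewrite poch2_inf_recl /heine_cst mulrACA -invrM ?unit_poch2q_inf ?unit_heine_cst_den //.
by rewrite mulrCA mulrK // unitrM unit_poch2q_inf unit_heine_cst_den.
Qed.

(** The boundary term at N equals U (1 - y) R1 by [heine_coefS], with U, y, R1, R2 as set in the
    proof. Adding the terms of index N + 1 and replacing (1 - z s y) R1 by (1 + q s y) R2 leaves U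
    (1 - w y) R2, the next boundary term. *)
Lemma psi_telescope j N :
  (1 - z * q ^+ (2 * j)) * (\sum_(k < N.+1) psi_term j k)
  - (w + q ^+ (2 * j).+1) * (\sum_(k < N.+1) psi_term j.+1 k)
  = heine_coef N * (1 - w * q ^+ (2 * N)) * tail_ratio (j + N).+1.
Proof.
elim: N => [|N IH].
  rewrite !big_ord_recl !big_ord0 /psi_term heine_coef0 !addr0 !addn0 muln0 expr0 !mul1r tail_ratio_rec.
  by rewrite exprS; ring.
rewrite big_ord_recr [X in _ - _ * X]big_ord_recr /= !mulrDr opprD addrACA IH.
rewrite /psi_term !addSn !addnS -heine_coefS.
set U := heine_coef N.+1; set y := q ^+ (2 * N.+1).
have Rr := tail_ratio_rec (j + N).+1; set R1 := tail_ratio _ in Rr *; set R2 := tail_ratio _ in Rr *.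
move: Rr; have -> : (2 * (j + N).+1 = 2 * j + 2 * N.+1)%N by lia.
rewrite exprS exprD -/y [q ^+ (2 * j).+1]exprS; set s := q ^+ (2 * j) => Rr.
transitivity (U * ((1 - z * (s * y)) * R1) - U * y * (w + q * s) * R2); first by ring.
by rewrite Rr; ring.
Qed.

Lemma Psi_rec j : (1 - z * q ^+ (2 * j)) * Psi j =
  (1 - w) + (w + q ^+ (2 * j).+1) * Psi j.+1.
Proof.
apply/eqP; rewrite -subr_eq; apply/eqP.
pose s N := heine_cst * (heine_coef N * (1 - w * q ^+ (2 * N)) * tail_ratio (j + N).+1).
apply: (lim_uniq (s := s)).
  pose s' N := (1 - z * q ^+ (2 * j)) * (heine_cst * \sum_(k < N.+1) psi_term j k) -
     (w + q ^+ (2 * j).+1) * (heine_cst * \sum_(k < N.+1) psi_term j.+1 k).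
  apply: (@lim_ext s') => [N|]; first by rewrite /s -psi_telescope /s'; ring.
  by apply: limB; apply: limZ; exact: limS (@Psi_lim _).
(* In the boundary term the last two factors tend to 1, and the rest tends to 1 - w. *)
rewrite -heine_cst_coef; apply: limZ.
rewrite -[X in lim_to _ X]mulr1 -[X in lim_to _ (X * _)]mulr1; apply: limM.
  apply: limM; first exact: heine_coef_lim.
  move=> N; rewrite -[X in eqm _ _ X]subr0; apply: eqmB => //.
  by rewrite mulrC; apply: eqm_qX; lia.
by move=> N; apply: eqmW (@tail_ratio_eqm1 _); lia.
Qed.

(* The q-binomial theorem at [x = q^2], where the partial sums telescope. *)
Lemma sum_heine_coef N : \sum_(k < N.+1) heine_coef k * q ^+ (2 * k) = poch2 (w * q ^+ 2) N / poch2 (q ^+ 2) N.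
Proof.
have H M : heine_coef M * (1 - w * q ^+ (2 * M)) = (1 - w) * (poch2 (w * q ^+ 2) M / poch2 (q ^+ 2) M).
  by rewrite /heine_coef mulrAC -poch2S poch2_recl -[LHS]mulrA.
elim: N => [|N IH]; first by rewrite big_ord_recl big_ord0 heine_coef0 !poch2_0 muln0 divr1 expr0 mulr1 addr0.
rewrite big_ord_recr /= IH.
have U1 : 1 - q ^+ (2 * N.+1) \is a GRing.unit.
  by rewrite -[q ^+ _]mul1r unit_1BqM ?muln_gt0.
(* With Y = q^(2N+2), the common factor (wQ;Q)_N / (Q;Q)_N is multiplied by (1 - Y) + (1 - w) Y = 1
   - w Y. *)
apply: (mulIr U1); rewrite mulrDl [heine_coef _ * _ * _]mulrAC heine_coefS H.
have E : q ^+ (2 * N.+1) = q ^+ 2 * q ^+ (2 * N).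
  by rewrite -exprD; congr (q ^+ _); lia.
have U2 : 1 - q ^+ 2 * q ^+ (2 * N) \is a GRing.unit by rewrite -E.
rewrite !poch2S E (mulf_ratio_cancel _ _ (unit_poch2q N) U2).
by rewrite -[w * q ^+ 2 * _]mulrA -E; ring.
Qed.

Lemma lim_eqm s t l m N : lim_to s l -> lim_to t m -> (forall j, eqm N (s j) (t j)) -> eqm N l m.
Proof.
move=> sl tm st; apply: (@eqm_trans _ (s N)); first exact: eqm_sym (sl N).
by apply: (@eqm_trans _ (t N)); first exact: st.
Qed.

(** Modulo q^j every [tail_ratio (j + k)] is 1, and the remaining sum of
    [heine_coef k * q ^+ (2 * k)] is (wQ;Q)_oo / (Q;Q)_oo, the inverse of [heine_cst]. *)
Lemma Psi_eqm1 j : eqm j (Psi j) 1.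
Proof.
apply: (lim_eqm (s := fun N => heine_cst * \sum_(k < N.+1) psi_term j k)
                (t := fun N => heine_cst * \sum_(k < N.+1) heine_coef k * q ^+ (2 * k))).
- exact: limS (@Psi_lim j).
- apply: (@lim_ext (fun N => heine_cst * (poch2 (w * q ^+ 2) N / poch2 (q ^+ 2) N))) => [N|].
    by rewrite sum_heine_coef.
  have -> : 1 = heine_cst * (poch2_inf (w * q ^+ 2) / poch2_inf (q ^+ 2)).
    rewrite /heine_cst mulrACA [RHS]mulrA.
    by rewrite mulrK ?unit_heine_cst_den // mulrV // unit_poch2q_inf.
  apply: limZ; apply: limM; first exact: poch2_lim.
  by apply: limV; [exact: unit_poch2q | exact: unit_poch2q_inf | exact: poch2_lim].
move=> N; apply: eqmM => //; apply: eqm_sum => k _.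
rewrite -[X in eqm _ _ X]mulr1; apply: eqmM => //.
by apply: eqmW (@tail_ratio_eqm1 _); lia.
Qed.

(* Both sides satisfy the same first-order recursion and tend to 1, so their
   difference at [j] is a multiple of the one at [j + i], which is [O(q^(j+i))]. *)
Lemma Phi_eq_Psi j : (0 < j)%N -> Phi j = Psi j.
Proof.
move=> j0; apply/eqP; rewrite -subr_eq0; apply/eqP.
have step k : (0 < k)%N -> exists V, Phi k - Psi k = V * (Phi k.+1 - Psi k.+1).
  move=> k0; exists ((1 - z * q ^+ (2 * k))^-1 * (w + q ^+ (2 * k).+1)).
  have U1 : 1 - z * q ^+ (2 * k) \is a GRing.unit by apply: unit_1BqM; lia.
  apply: (mulrI U1); rewrite mulrA mulVKr // mulrBr Phi_rec // Psi_rec; ring.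
have iterate i : exists V, Phi j - Psi j = V * (Phi (j + i) - Psi (j + i)).
  elim: i => [|i [V ->]]; first by exists 1; rewrite addn0 mul1r.
  have [|V' ->] := step (j + i)%N; first by lia.
  by exists (V * V'); rewrite addnS mulrA.
apply: eqm_eq => N; have [V ->] := iterate N.
rewrite -[X in eqm _ _ X](mulr0 V); apply: eqmM => //.
rewrite -[X in eqm _ _ X](subrr 1); apply: eqmB.
  by apply: eqmW (@Phi_eqm1 _ _); lia.
by apply: eqmW (@Psi_eqm1 _); lia.
Qed.

(** Unlike [Phi 0], the series [Psi 0] converges, so its recursion is available at j = 0 and only
    Phi_1 = Psi_1 has to be supplied. *)
Lemma N2_gf_Psi0 : N2_gf = (1 - z) * Psi 0.
Proof.
have := Psi_rec 0; rewrite muln0 expr0 mulr1 expr1 => ->.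
by rewrite /N2_gf Phi_eq_Psi.
Qed.

(** * The terms of Psi_0: the M2 generating function and S2bar *)

Lemma M2_gfE : M2_gf = poch2_inf (- q) * poch2_inf (q ^+ 2)
  / (poch2_inf (z * q ^+ 2) * poch2_inf (w * q ^+ 2)).
Proof.
rewrite /M2_gf !fmonE fCN fC1 mulN1r mul1r expr1 fdivE //.
by rewrite unitrM !unit_poch2_inf.
Qed.

Lemma S2bar_termE n : (0 < n)%N ->
  S2bar_term n = q ^+ (2 * n) * (poch2_inf (q ^+ (2 * n + 2)) * poch2_inf (- q ^+ (2 * n + 1)))
   / (poch2_inf (z * q ^+ (2 * n)) * poch2_inf (w * q ^+ (2 * n))).
Proof.
move=> n0; rewrite /S2bar_term !fmonE fCN fC1 mulN1r !mul1r fdivE //.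
by rewrite unitrM !unit_poch2_inf ?muln_gt0.
Qed.

Lemma psi_termE k : (0 < k)%N -> heine_cst * psi_term 0 k = (1 - w) * S2bar_term k.
Proof.
move=> k0; rewrite S2bar_termE // /psi_term add0n /tail_ratio /heine_cst /heine_coef.
have k2 : (0 < 2 * k)%N by lia.
have E1 : poch2_inf (q ^+ 2) = poch2 (q ^+ 2) k * poch2_inf (q ^+ (2 * k + 2)).
  by rewrite (poch2_infE _ k) -exprD addnC.
have E2 : (1 - w) * poch2_inf (w * q ^+ 2) = poch2 w k * poch2_inf (w * q ^+ (2 * k)).
  by rewrite -poch2_inf_recl -poch2_infE.
(* All products become variables related by [E2] alone; what is left is a cancellation of units. *)
have := unit_heine_cst_den; have := unit_poch2_inf w k2; have := unit_poch2_inf z k2.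
have := unit_poch2q k; rewrite E1 addn1.
move: E2; move: (poch2_inf (w * q ^+ 2)) (poch2_inf (w * q ^+ (2 * k))) (poch2_inf (z * _)).
move: (poch2 w k) (poch2 (q ^+ 2) k) (poch2_inf (q ^+ _)) (poch2_inf (- _)) (q ^+ (2 * k)).
move=> pw pq a b y A B C E uq uC uB uA.
apply: (mulrI uA); apply: (mulIr uB).
rewrite [C * B]mulrC !invrM // !mulrA.
have -> : A * pq * a / A * pw / pq * y * b / C * B = (A / A) * (pq / pq) * (pw * B) * (a * y * b / C) by ring.
rewrite -E mulrV // mulrV //.
have -> : A * (1 - w) * y * a * b / C / B * B = (1 - w) * A * (a * y * b / C) * (B / B) by ring.
by rewrite mulrV // !mul1r mulr1.
Qed.

(** The factor 1 - z cancels the first factor of (z;Q)_oo and leaves (zQ;Q)_oo. *)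
Lemma psi_term00 : (1 - z) * (heine_cst * psi_term 0 0) = M2_gf.
Proof.
rewrite M2_gfE /psi_term heine_coef0 mul1r muln0 expr0 mul1r addn0.
have H : (1 - z) * tail_ratio 0 = (1 + q) * tail_ratio 1.
  by have := tail_ratio_rec 0; rewrite muln0 expr0 mulr1 expr1.
rewrite mulrCA H /tail_ratio /heine_cst.
have -> : poch2_inf (- q) = (1 + q) * poch2_inf (- q ^+ (2 * 1).+1).
  by rewrite poch2_inf_recl opprK mulNr -exprS.
by rewrite invrM ?unit_heine_cst_den ?unit_poch2_inf // muln1; ring.
Qed.

Lemma S2bar_lim : lim_to (fun N => (1 - z) * (1 - w) * \sum_(k < N) S2bar_term k.+1)
   ((1 - z) * (1 - w) * S2bar).
Proof.
apply: limZ; apply: lim_sum => k; rewrite S2bar_termE // -mulrA.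
by apply: eqm_qX; lia.
Qed.

Lemma N2_gf_decomp : N2_gf = M2_gf + (1 - z) * (1 - w) * S2bar.
Proof.
rewrite N2_gf_Psi0.
apply: (lim_uniq (s := fun N => (1 - z) * (heine_cst * \sum_(k < N.+1) psi_term 0 k))).
  apply: limZ; exact: limS (@Psi_lim 0).
apply: (@lim_ext (fun N => M2_gf + (1 - z) * (1 - w) * \sum_(k < N) S2bar_term k.+1)) => [N|].
  rewrite big_ord_recl [heine_cst * _]mulrDr [RHS]mulrDr psi_term00; congr (_ + _).
  rewrite -mulrA; congr (_ * _); rewrite !mulr_sumr.
  by apply: eq_bigr => k _; rewrite -psi_termE.
by apply: limD => //; exact: S2bar_lim.
Qed.

(** * Partitions without repeated odd parts *)

(* The [i]-th factor accounts for the parts equal to [i + 1]. *)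
Definition part_fac i : fps :=
  if odd i.+1 then 1 + w * q ^+ i.+1 else (1 - w * q ^+ i.+1)^-1.

Lemma G_prod L : G L = \prod_(i < 2 * L) part_fac i.
Proof.
elim: L => [|L IH]; first by rewrite muln0 big_ord0 G0.
rewrite mulnS !add2n !big_ord_recr /= -IH /part_fac /= oddM /=.
have U : 1 - w * q ^+ (2 * L).+2 \is a GRing.unit by apply: unit_1BqM.
apply: (mulIr U); rewrite mulrVK //.
by have := G_rec L; rewrite mulnS add2n.
Qed.

(** [part_fac i] cut off at multiplicity n, so that the index type is the range of the multiplicity
    functions. *)
Definition part_sum n i : fps :=
  \sum_(a < n.+1 | odd i.+1 ==> (a <= 1)%N) w ^+ a * q ^+ (i.+1 * a).

Lemma part_fac_eqm n i : (i < n)%N -> eqm n.+1 (part_fac i) (part_sum n i).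
Proof.
rewrite /part_fac /part_sum; case: (odd i.+1) => /=.
  case: n => // n _; rewrite big_mkcond /= !big_ord_recl big1 //=.
  by rewrite !expr0 muln0 mul1r addr0 !expr1 muln1.
move=> lt_in; have h0 : (w * q ^+ i.+1) 0%N = 0 by apply: coef0_qM.
rewrite geomE; last by rewrite coefBf h0 subr0.
rewrite opprB addrC subrK; apply: (eqm_trans (geom_eqm (N := n.+1) h0)).
by apply: eqm_sum => a _; rewrite exprMn -exprM.
Qed.

Lemma part_fac_eqm1 n i : (n <= i)%N -> eqm n.+1 (part_fac i) 1.
Proof.
move=> le_ni; have h0 : eqm n.+1 (w * q ^+ i.+1) 0.
  by rewrite mulrC; apply: eqm_qX.
rewrite /part_fac; case: ifP => _.
  by rewrite -[X in eqm _ _ X]addr0; apply: eqmD.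
rewrite -[X in eqm _ _ X]invr1; apply: eqmV; rewrite ?unitr1 ?unit_1BqM //.
by rewrite -[X in eqm _ _ X]subr0; apply: eqmB.
Qed.

(** There are 2L factors on one side and n on the other. Both products are widened to 2L + n
    factors; those with i >= n are 1 modulo q^(n+1). *)
Lemma G_eqm L n :
  eqm n.+1 (G L) (\prod_(i < n) if (i < 2 * L)%N then part_sum n i else 1).
Proof.
rewrite G_prod (big_ord_widen (2 * L + n)%N) ?leq_addr // big_mkcond /=.
rewrite (big_ord_widen (2 * L + n)%N (fun i => if (i < 2 * L)%N then part_sum n i else 1)) ?leq_addl //.
rewrite [X in eqm _ _ X]big_mkcond /=; apply: eqm_prod => i _.
case: ifP => _; last by rewrite if_same.
by case: ltnP => ?; [apply: part_fac_eqm | apply: part_fac_eqm1].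
Qed.

Definition valid_ptn n (f : {ffun 'I_n -> 'I_n.+1}) :=
  (ptn_sum f == n) && ptn_no_rep_odd f.

(** Turns the bound on the largest part into a condition on each multiplicity separately, as needed
    to expand a product of sums. *)
Lemma uphalf_largest_leq n (f : {ffun 'I_n -> 'I_n.+1}) L :
  (uphalf (ptn_largest f) <= L)%N = [forall i : 'I_n, (i < 2 * L)%N || (f i == 0%N :> nat)].
Proof.
rewrite leq_uphalf_double -mul2n; apply/bigmax_leqP/forallP => H i.
  by case: (posnP (f i)) => [_|/H ->]; rewrite ?orbT.
by have := H i; rewrite lt0n => /orP[->|->].
Qed.

Lemma coefG L n : G L n =
  \sum_(f : {ffun 'I_n -> 'I_n.+1} | valid_ptn f && (uphalf (ptn_largest f) <= L)%N)
    zK^-1 ^+ ptn_nparts f.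
Proof.
rewrite (G_eqm L (ltnSn n)).
pose Q (i : 'I_n) (a : 'I_n.+1) := (odd i.+1 ==> (a <= 1)%N) && ((i < 2 * L)%N || (a == 0%N :> nat)).
have -> : \prod_(i < n) (if (i < 2 * L)%N then part_sum n i else 1)
   = \prod_(i < n) \sum_(a | Q i a) w ^+ a * q ^+ (i.+1 * a).
  apply: eq_bigr => i _; rewrite /part_sum /Q; case: ifP => _.
    by apply: eq_bigl => a; rewrite andbT.
  rewrite (big_pred1 ord0) /= ?expr0 ?muln0 ?mulr1 // => a /=.
  by rewrite -val_eqE /=; case: (nat_of_ord a) => [|a'] /=; rewrite ?implybT // andbF.
(* Choosing one multiplicity in each factor amounts to choosing f, which contributes the monomial
   w^(number of parts) q^(sum of parts). *)
rewrite bigA_distr_big_dep coef_sumf.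
rewrite (eq_bigr (fun f : {ffun 'I_n -> 'I_n.+1} => if ptn_sum f == n then zK^-1 ^+ ptn_nparts f else 0)).
  rewrite -big_mkcondr; apply: eq_bigl => f; rewrite /valid_ptn uphalf_largest_leq andbC -andbA; congr (_ && _).
  apply/familyP/andP => [H|[/forallP H1 /forallP H2] i].
    by split; apply/forallP => i; have /andP[] := H i.
  by apply/andP; split.
move=> f _; rewrite big_split /= -!expr_sum.
by rewrite -fCX -fmonE /fmon eq_sym.
Qed.

Lemma zK_exp_rank a b : zK ^+ a * zK^-1 ^+ b = zK ^ (a%:Z - b%:Z).
Proof. by rewrite expfzDr ?zK_neq0 // exprVn -exprnN. Qed.

Lemma ptn_largest_le n (f : {ffun 'I_n -> 'I_n.+1}) : (ptn_largest f <= n)%N.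
Proof. by apply/bigmax_leqP => i _. Qed.

Lemma ptn_nparts_le n (f : {ffun 'I_n -> 'I_n.+1}) : (ptn_nparts f <= ptn_sum f)%N.
Proof. by apply: leq_sum => i _; rewrite mulSn leq_addr. Qed.

Lemma uphalf_largest_lt n (f : {ffun 'I_n -> 'I_n.+1}) : (uphalf (ptn_largest f) < n.+1)%N.
Proof. by rewrite ltnS leq_uphalf_double -addnn (leq_trans (ptn_largest_le f)) ?leq_addl. Qed.

(** G_{L+1} - G_L keeps the partitions with ceil(largest part / 2) = L + 1, and z^(L+1) w^(number of
    parts) is z to the M2-rank. *)
Lemma coef_N2_gf n : N2_gf n =
  \sum_(f : {ffun 'I_n -> 'I_n.+1} | valid_ptn f) zK ^ (M2rank f).
Proof.
pose up (f : {ffun 'I_n -> 'I_n.+1}) := uphalf (ptn_largest f).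
pose S L := \sum_(f : {ffun 'I_n -> 'I_n.+1} | valid_ptn f && (up f == L)) zK^-1 ^+ ptn_nparts f.
have GB L : G L.+1 n - G L n = S L.+1.
  rewrite !coefG (bigID (fun f => up f == L.+1)) /= addrC.
  apply/eqP; rewrite subr_eq addrC; apply/eqP; congr (_ + _).
    by apply: eq_bigl => f; rewrite -andbA; congr (_ && _); rewrite /up; lia.
  by apply: eq_bigl => f; rewrite -andbA; congr (_ && _); rewrite /up; lia.
have S0 : (1 : fps) n = S 0%N.
  by rewrite -G0 coefG; apply: eq_bigl => f; rewrite leqn0.
(* Coefficient n of the limit is already that of the partial sum of index n + 1. *)
rewrite -(N2_gf_lim (ltnSn n)) /N2_gf_part coefDf S0 coef_sumf.
transitivity (\sum_(L < n.+2) zK ^+ L * S L).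
  rewrite [RHS]big_ord_recl /= expr0 mul1r; congr (_ + _); apply: eq_bigr => L _.
  by rewrite -GB -coefBf -coefMCf fCX.
pose h f : 'I_n.+2 := inord (up f).
have hE f : h f = up f :> nat by rewrite inordK // ltnW // ltnS uphalf_largest_lt.
rewrite [RHS](partition_big h xpredT) //=; apply: eq_bigr => L _.
rewrite mulr_sumr; apply: eq_big => [f|f /andP[_ /eqP <-]]; first by rewrite -val_eqE /= hE.
by rewrite zK_exp_rank.
Qed.

(** * Laurent polynomials *)

Definition laurent_sum (c : int -> int) (N : nat) : K :=
  \sum_(i < (2 * N).+1) (c (i%:Z - N%:Z))%:~R * zK ^ (i%:Z - N%:Z).

(** [laurent] selects its bound by choice; this makes the value independent of the bound, any two
    being compared at their maximum. *)
Lemma laurent_sum_widen c N M : (forall m : int, (N < absz m)%N -> c m = 0) ->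
  (N <= M)%N -> laurent_sum c M = laurent_sum c N.
Proof.
move=> c0 /subnKC <-; elim: (M - N)%N => [|d <-]; first by rewrite addn0.
rewrite addnS {1}/laurent_sum mulnS add2n big_ord_recl big_ord_recr /=.
rewrite !c0 ?mul0r ?add0r ?addr0; [|rewrite /bump; lia|lia].
apply: eq_bigr => i _.
by have -> : (bump 0 i)%:Z - (N + d).+1%:Z = i%:Z - (N + d)%:Z by rewrite /bump; lia.
Qed.

Lemma laurentE c N : (forall m : int, (N < absz m)%N -> c m = 0) ->
  laurent c = laurent_sum c N.
Proof.
move=> c0; rewrite /laurent; case: ClassicalEpsilon.excluded_middle_informative => [H|[]]; last by exists N.
case: (ClassicalEpsilon.constructive_indefinite_description _ H) => N' c0' /=.
rewrite -[LHS]/(laurent_sum c N').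
by rewrite -(laurent_sum_widen c0 (leq_maxl N N')) -(laurent_sum_widen c0' (leq_maxr N N')).
Qed.

Lemma laurent_sumB a b N :
  laurent_sum (fun m => a m - b m) N = laurent_sum a N - laurent_sum b N.
Proof.
rewrite /laurent_sum -sumrB; apply: eq_bigr => i _.
by rewrite rmorphB mulrBl.
Qed.

(** * Series whose coefficients are Laurent polynomials in z *)

Definition islaur (x : K) :=
  exists pk : {poly int} * nat, x = FracField.tofrac pk.1 / zK ^+ pk.2.

Lemma islaur_tofrac p : islaur (FracField.tofrac p).
Proof. by exists (p, 0%N); rewrite divr1. Qed.
Lemma islaur0 : islaur 0.
Proof. by rewrite -tofrac0; apply: islaur_tofrac. Qed.
Lemma islaur1 : islaur 1.
Proof. by rewrite -tofrac1; apply: islaur_tofrac. Qed.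
Lemma islaur_z : islaur zK.
Proof. exact: islaur_tofrac. Qed.
Lemma islaur_zV : islaur zK^-1.
Proof. by exists (1, 1%N); rewrite tofrac1 div1r. Qed.
Lemma islaurN x : islaur x -> islaur (- x).
Proof. by move=> [[p k] /= ->]; exists (- p, k); rewrite tofracN mulNr. Qed.
Lemma islaurM x y : islaur x -> islaur y -> islaur (x * y).
Proof.
move=> [[p k] /= ->] [[p' k'] /= ->]; exists (p * p', (k + k')%N) => /=.
by rewrite tofracM mulrACA exprD invfM.
Qed.
Lemma islaurD x y : islaur x -> islaur y -> islaur (x + y).
Proof.
move=> [[p k] /= ->] [[p' k'] /= ->].
exists (p * 'X^k' + p' * 'X^k, (k + k')%N) => /=.
rewrite tofracD !tofracM !tofracXn -/zK exprD.
by rewrite addf_div ?expf_neq0 ?zK_neq0.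
Qed.

Definition flaur (f : fps) := forall n, islaur (f n).

Lemma flaur_sum I (r : seq I) (P : pred I) (F : I -> fps) :
  (forall i, P i -> flaur (F i)) -> flaur (\sum_(i <- r | P i) F i).
Proof.
move=> lF; apply: big_ind => // [n|f g lf lg n]; first by rewrite coef0f; apply: islaur0.
by apply: islaurD.
Qed.
Lemma flaur_fC c : islaur c -> flaur (fC c).
Proof. by move=> lc [|n] //; apply: islaur0. Qed.
Lemma flaur1 : flaur 1. Proof. exact: flaur_fC islaur1. Qed.
Lemma flaurB f g : flaur f -> flaur g -> flaur (f - g).
Proof. by move=> lf lg n; apply: islaurD => //; apply: islaurN. Qed.
Lemma flaurM f g : flaur f -> flaur g -> flaur (f * g).
Proof.
move=> lf lg n; rewrite coefMf; apply: big_ind; first exact: islaur0.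
  exact: islaurD.
by move=> i _; apply: islaurM.
Qed.
Lemma flaur_q : flaur q.
Proof. by move=> n; rewrite /q /fmon; case: ifP => _; [apply: islaur1 | apply: islaur0]. Qed.
Lemma flaurX f k : flaur f -> flaur (f ^+ k).
Proof.
by move=> lf; elim: k => [|k IH]; [apply: flaur1 | rewrite exprS; apply: flaurM].
Qed.
(** With constant coefficient 1 the inverse is a geometric series, computed without any division in
    [K]. *)
Lemma flaurV (f : fps) : f 0%N = 1 -> flaur f -> flaur f^-1.
Proof.
move=> f0 lf n; rewrite geomE // /geom; apply: flaur_sum => k _.
by apply: flaurX; apply: flaurB => //; apply: flaur1.
Qed.
Lemma flaur_poch2_inf a : flaur a -> flaur (poch2_inf a).
Proof.
move=> la n; rewrite -(poch2_lim _ (ltnSn n)).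
have lN N : flaur (poch2 a N); last exact: lN.
elim: N => [|N IH]; first exact: flaur1.
rewrite poch2S; apply: flaurM => //; apply: flaurB; first exact: flaur1.
by apply: flaurM => //; apply: flaurX; apply: flaur_q.
Qed.

(** Guarantees that [lcoeff] does not fall back on its default value 0 in the definition of [M2]. *)
Lemma flaur_M2_gf : flaur M2_gf.
Proof.
have lq k : flaur (q ^+ k) by apply/flaurX/flaur_q.
have lz : flaur z by apply/flaur_fC/islaur_z.
have lw : flaur w by apply/flaur_fC/islaur_zV.
rewrite M2_gfE; apply: flaurM.
  apply: flaurM; apply: flaur_poch2_inf => //.
  by rewrite -[- q]mulN1r -sub0r mulrBl mul0r mul1r; apply: flaurB => //; [apply/flaur_fC/islaur0 | apply: flaur_q].
apply: flaurV; first by rewrite coef0Mf !coef0_poch2_inf !coef0_qM // subr0 mulr1.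
by apply: flaurM; apply: flaur_poch2_inf; apply: flaurM.
Qed.

Lemma tofrac_int (a : int) : FracField.tofrac (a%:P : {poly int}) = a%:~R.
Proof. by rewrite -{1}(intz a) !rmorph_int. Qed.

Lemma laurent_lcoeff x : islaur x -> exists2 N,
  (forall m : int, (N < absz m)%N -> lcoeff x m = 0) &
  laurent_sum (lcoeff x) N = x.
Proof.
move=> lx; rewrite /laurent_sum /lcoeff.
case: ClassicalEpsilon.excluded_middle_informative => // H.
case: (ClassicalEpsilon.constructive_indefinite_description _ H) => -[p k] /= xE.
have [sp [p0 pE]] : exists s : nat, (forall i, (s <= i)%N -> p`_i = 0) /\ p = \poly_(i < s) p`_i.
  by exists (size p); split=> [i|]; [apply: nth_default | rewrite coefK].
(* The exponents of p / z^k lie between -k and sp - 1 - k. In the sum below, the indices from sp to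
   2 sp - 1 carry the coefficients of p, and the terms on either side vanish. *)
exists (k + sp)%N => [m lt_m|].
  by case: ifP => // ?; rewrite p0 //; lia.
rewrite -(big_mkord xpredT (fun i : nat => (if 0 <= i%:Z - (k + sp)%:Z + k%:Z then
   p`_`|(i%:Z - (k + sp)%:Z + k%:Z)%R| else 0)%:~R * zK ^ (i%:Z - (k + sp)%:Z))).
rewrite (big_cat_nat (n := sp)) //=; last by lia.
rewrite big_nat_cond big1 ?add0r; last first.
  by move=> i /andP[/andP[_ lt_i] _]; rewrite ifF ?mul0r //; lia.
rewrite -{1}[sp]add0n big_addn.
rewrite (big_cat_nat (n := sp)) //=; last by lia.
rewrite [X in _ + X]big_nat_cond [X in _ + X]big1 ?addr0; last first.
  move=> i /andP[/andP[le_i _] _]; rewrite p0 ?if_same ?mul0r //; lia.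
rewrite xE [in RHS]pE poly_def rmorph_sum mulr_suml big_mkord.
apply: eq_bigr => i _.
have -> : (i + sp)%:Z - (k + sp)%:Z = i%:Z - k%:Z by lia.
rewrite subrK /= -mul_polyC tofracM tofrac_int tofracXn -/zK -mulrA; congr (_ * _).
by rewrite -zK_exp_rank exprVn.
Qed.

(** * Comparison of the coefficients of N2 and M2 *)

Lemma laurent_N2 n N : (n <= N)%N ->
  (forall m : int, (N < absz m)%N -> N2 m n = 0%N) /\
  laurent_sum (fun m => (N2 m n)%:Z) N = N2_gf n.
Proof.
move=> nN.
(* The rank is a difference of two numbers between 0 and n. *)
have bnd (f : {ffun 'I_n -> 'I_n.+1}) : valid_ptn f -> (absz (M2rank f) <= N)%N.
  move=> /andP[/eqP sf _]; have := ptn_nparts_le f; have := uphalf_largest_lt f.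
  by rewrite sf /M2rank; lia.
split=> [m lt_m|].
  apply: eq_card0 => f; rewrite !inE andbA; apply/negbTE/negP => /andP[/bnd + /eqP E].
  by rewrite E; lia.
rewrite coef_N2_gf /laurent_sum.
pose h (f : {ffun 'I_n -> 'I_n.+1}) : 'I_(2 * N).+1 := inord (absz (M2rank f + N%:Z)).
rewrite [RHS](partition_big h xpredT) //=; apply: eq_bigr => i _.
have hE f : valid_ptn f -> (h f == i) = (M2rank f == i%:Z - N%:Z).
  by move=> /bnd vf; rewrite -val_eqE /= inordK; lia.
rewrite (eq_big (fun f => valid_ptn f && (M2rank f == i%:Z - N%:Z)) (fun=> zK ^ (i%:Z - N%:Z))).
- rewrite sumr_const -pmulrn mulr_natl; congr (_ *+ _); rewrite /N2.
  by apply: eq_card => f; rewrite !inE andbA.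
- by move=> f; case vf : (valid_ptn f) => //=; rewrite hE.
by move=> f /andP[vf]; rewrite hE // => /eqP ->.
Qed.

Theorem theorem2p2 :
  fmul (fC ((1 - zK) * (1 - zK^-1))) S2bar =
  (fun n : nat => laurent (fun m : int => (N2 m n)%:Z - M2 m n)).
Proof.
apply: fps_eqP => n.
have [N0 c0 sumN0] := laurent_lcoeff (flaur_M2_gf n).
(* [maxn n N0] bounds the exponents of both families, so the two Laurent sums can be subtracted
   termwise. *)
have le_n := leq_maxl n N0; have [d0 sumN] := laurent_N2 le_n.
rewrite (@laurentE _ (maxn n N0)) => [|m lt_m]; last first.
  by rewrite d0 // /M2 c0 ?subr0 // (leq_ltn_trans _ lt_m) ?leq_maxr.
rewrite laurent_sumB sumN (laurent_sum_widen c0) ?leq_maxr // sumN0 N2_gf_decomp.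
by rewrite coefDf [M2_gf n + _]addrC addrK fCM !fCD !fCN.
Qed.
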